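(* Let $n \geq 3$ be an integer. Then for every $j \in [2^n]$, $$w_n\big(G_n, \boldsymbol{\pi}^{(n;\,j)}\big) = j ,$$ where $G_n$ is the majority graph and $\boldsymbol{\pi}^{(n;\,j)}$ are the brackets defined in the context, and $w_n$ is the winner map of the knockout tournament.
   Context: For a positive integer $m$, $[m]=\{1,\dots,m\}$. $\Pi(n)$ is the set of permutations of $[2^n]$, each written as a list $\boldsymbol{\pi}=(\boldsymbol{\pi}(1),\dots,\boldsymbol{\pi}(2^n))$; a permutation used as the initial order of candidates is called a bracket. $\mathcal{H}(n)$ is the set of complete directed graphs (tournaments) with vertex set $[2^n]$: no loops, and for any two distinct vertices $a,b$ exactly one of $(a,b)$, $(b,a)$ is an arrow. The arrow $(a,b)$ means that $a$ beats $b$. Knockout tournament and $w_n$: given $G\in\mathcal{H}(n)$ and $\boldsymbol{\pi}\in\Pi(n)$, in the first round the candidates in positions $2t-1$ and $2t$ of $\boldsymbol{\pi}$ are matched for $t=1,\dots,2^{n-1}$; the winner of a match between $a$ and $b$ is $a$ if $(a,b)$ is an arrow of $G$ and $b$ otherwise. The winners, kept in the same relative order, form a list of length $2^{n-1}$, to which the same procedure is applied, and so on for $n$ rounds. $w_n(G,\boldsymbol{\pi})\in[2^n]$ is the single remaining candidate (the winner). Graph $G_3=([8],E_3)$: $E_3$ consists of the 28 arrows $(1,2),(1,3),(1,5),(2,3),(2,4),(2,6),(2,7),$ $(3,4),(3,5),(3,6),(3,8),(4,1),(4,5),(4,8),$ $(5,2),(5,6),(5,7),(6,1),(6,4),(6,7),(6,8),$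 $(7,1),(7,3),(7,4),(7,8),(8,1),(8,2),(8,5).$ Classes: for $q\in[2^{n-3}]$ let $C_q=[8q]\setminus[8(q-1)]$; these partition $[2^n]$. Write $i\sim j$ if $i,j$ lie in the same class. Graph $G_n=([2^n],E_n)$ for $n\ge 4$: for $i,j$ in the same class $C_q$, $(i,j)\in E_n$ if and only if $(i-8(q-1),\,j-8(q-1))\in E_3$. For $i<j$ in different classes, $(i,j)\in E_n$ if $i+j$ is even, and $(j,i)\in E_n$ if $i+j$ is odd. Base permutations of $[8]$: $\boldsymbol{\pi}^{(1)}=(1,2,3,4,5,6,7,8)$, $\boldsymbol{\pi}^{(2)}=(2,3,4,1,6,7,8,5)$, $\boldsymbol{\pi}^{(3)}=(3,6,4,1,8,2,5,7)$, $\boldsymbol{\pi}^{(4)}=(4,1,8,2,5,6,7,3)$, $\boldsymbol{\pi}^{(5)}=(5,6,7,8,2,3,4,1)$, $\boldsymbol{\pi}^{(6)}=(6,7,8,5,1,2,3,4)$, $\boldsymbol{\pi}^{(7)}=(7,8,1,2,3,5,6,4)$, $\boldsymbol{\pi}^{(8)}=(8,1,5,6,2,3,7,4)$. Brackets: for $k\in[2^n]$ let $b_k=\lceil k/8\rceil-1$ (so $k\in C_{b_k+1}$). For $j\in[2^n]$ and $k\in[2^n]$: - if $k\sim j$: $\boldsymbol{\pi}^{(n;\,j)}(k)=\boldsymbol{\pi}^{(j-8b_k)}(k-8b_k)+8b_k$; - if $k\not\sim j$ and $k<j$: $\boldsymbol{\pi}^{(n;\,j)}(k)=\boldsymbol{\pi}^{(1)}(k-8b_k)+8b_k$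 when $j$ is even, and $\boldsymbol{\pi}^{(2)}(k-8b_k)+8b_k$ when $j$ is odd; - if $k\not\sim j$ and $k>j$: $\boldsymbol{\pi}^{(n;\,j)}(k)=\boldsymbol{\pi}^{(2)}(k-8b_k)+8b_k$ when $j$ is even, and $\boldsymbol{\pi}^{(1)}(k-8b_k)+8b_k$ when $j$ is odd. For $n=3$ this gives $\boldsymbol{\pi}^{(3;\,j)}=\boldsymbol{\pi}^{(j)}$. *)

(* Defs.v *)
From mathcomp Require Import all_boot.
From mathcomp Require Import zify.

Set Implicit Arguments.
Unset Strict Implicit.
Unset Printing Implicit Defensive.

(* Candidates are the natural numbers 1, ..., 2 ^ n, so that parities and
   arithmetic on labels read exactly as in the mathematical text. *)
Definition upto (m : nat) : pred nat := [pred i | 0 < i <= m].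

Record tournament (n : nat) := Tournament {
  arrow :> rel nat;
  _ : forall a b, arrow a b -> (a \in upto (2 ^ n)) && (b \in upto (2 ^ n));
  _ : forall a, ~~ arrow a a;
  _ : forall a b, a \in upto (2 ^ n) -> b \in upto (2 ^ n) -> a != b ->
        arrow a b (+) arrow b a
}.

Record bracket (n : nat) := Bracket {
  bracket_seq :> seq nat;
  bracket_perm : perm_eq bracket_seq (iota 1 (2 ^ n))
}.

Definition match_winner (G : rel nat) (a b : nat) : nat := if G a b then a else b.

(* The last branch is only reached with the empty list when the size is even. *)
Fixpoint play_round (G : rel nat) (s : seq nat) : seq nat :=
  if s is a :: b :: s' then match_winner G a b :: play_round G s' else s.

(* After n rounds exactly one candidate remains, see [size_rounds]; the default
   value 0 of [head] is never used. *)
Definition winner (n : nat) (G : tournament n) (p : bracket n) : nat :=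
  head 0 (iter n (play_round G) p).

Lemma size_play_round G m s : size s = m.*2 -> size (play_round G s) = m.
Proof.
elim: m s => [|m IHm] [|a [|b s]] //= [sz_s].
by rewrite (IHm s).
Qed.

Lemma size_rounds n (G : tournament n) (p : bracket n) :
  size (iter n (play_round G) p) = 1.
Proof.
have : size p = 2 ^ n by rewrite (perm_size (bracket_perm p)) size_iota.
move: (bracket_seq p) => s; move: (arrow G) => R; elim: {p G} n s => [|m IHm] s //.
rewrite expnS mul2n => sz_s; rewrite iterSr; apply: IHm.
exact: size_play_round.
Qed.

Definition E3 : seq (nat * nat) :=
  [:: (1,2); (1,3); (1,5); (2,3); (2,4); (2,6); (2,7);
      (3,4); (3,5); (3,6); (3,8); (4,1); (4,5); (4,8);
      (5,2); (5,6); (5,7); (6,1); (6,4); (6,7); (6,8);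
      (7,1); (7,3); (7,4); (7,8); (8,1); (8,2); (8,5)].

(* b_k = ceil (k / 8) - 1, so that k lies in the class C_(b_k + 1). *)
Definition blk (k : nat) : nat := (k + 7) %/ 8 - 1.

Definition same_class : rel nat := [rel i j | blk i == blk j].

Lemma same_classE i j : same_class i j = (blk i == blk j).
Proof. by []. Qed.

Lemma blkP k q : 0 < k -> (blk k == q) = (8 * q < k <= 8 * q.+1).
Proof. rewrite /blk => k_gt0; apply/eqP/idP; lia. Qed.

(* For i > j in different classes the rule is the one for the pair (j, i), with
   the roles exchanged.  For n = 3 there is only one class and the arrows are
   those of E3, see [Gn3E].  For n < 3 this restricts E3 to [2 ^ n], a value
   that is never used. *)
Definition Gn_arrow (n : nat) : rel nat := fun i j =>
  [&& i \in upto (2 ^ n), j \in upto (2 ^ n) &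
    if same_class i j then (i - 8 * blk i, j - 8 * blk i) \in E3
    else if i < j then ~~ odd (i + j) else odd (i + j)].

Lemma Gn_arrow_in n a b :
  Gn_arrow n a b -> (a \in upto (2 ^ n)) && (b \in upto (2 ^ n)).
Proof. by case/and3P=> -> ->. Qed.

Lemma E3_irr x : (x, x) \notin E3.
Proof. by do 9?[case: x => [//|x]]. Qed.

Lemma E3_total x y : x \in upto 8 -> y \in upto 8 -> x != y ->
  ((x, y) \in E3) (+) ((y, x) \in E3).
Proof. by do 9?[case: x => [|x] //]; do 9?[case: y => [|y] //]. Qed.

Lemma sub_blk k : 0 < k -> k - 8 * blk k \in upto 8.
Proof. rewrite /blk !inE; lia. Qed.

Lemma Gn_arrow_irr n a : ~~ Gn_arrow n a a.
Proof. by rewrite /Gn_arrow same_classE eqxx (negPf (E3_irr _)) !andbF. Qed.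

Lemma Gn_arrow_total n a b : a \in upto (2 ^ n) -> b \in upto (2 ^ n) ->
  a != b -> Gn_arrow n a b (+) Gn_arrow n b a.
Proof.
move=> a_in b_in ab; rewrite /Gn_arrow a_in b_in !andTb !same_classE.
rewrite [blk b == _]eq_sym.
have /andP[a_gt0 _] := a_in; have /andP[b_gt0 _] := b_in.
case: eqP => [eq_ab | _].
  rewrite -eq_ab; apply: E3_total; first exact: sub_blk.
    by rewrite eq_ab; apply: sub_blk.
  have := sub_blk a_gt0; have := sub_blk b_gt0; rewrite !inE; lia.
by rewrite [b + a]addnC; case: ltngtP ab => // _ _; case: odd.
Qed.

Definition Gn (n : nat) : tournament n :=
  Tournament (@Gn_arrow_in n) (@Gn_arrow_irr n) (@Gn_arrow_total n).

Lemma Gn3E i j : Gn 3 i j = ((i, j) \in E3).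
Proof. by do 9?[case: i => [|i] //]; do 9?[case: j => [|j] //]. Qed.

Definition base_perms : seq (seq nat) :=
  [:: [:: 1; 2; 3; 4; 5; 6; 7; 8];
      [:: 2; 3; 4; 1; 6; 7; 8; 5];
      [:: 3; 6; 4; 1; 8; 2; 5; 7];
      [:: 4; 1; 8; 2; 5; 6; 7; 3];
      [:: 5; 6; 7; 8; 2; 3; 4; 1];
      [:: 6; 7; 8; 5; 1; 2; 3; 4];
      [:: 7; 8; 1; 2; 3; 5; 6; 4];
      [:: 8; 1; 5; 6; 2; 3; 7; 4]].

(* Entry k of the l-th base permutation; both indices are 1-based. *)
Definition base (l k : nat) : nat := nth 0 (nth [::] base_perms l.-1) k.-1.

Definition pi_entry (j k : nat) : nat :=
  let b := blk k in
  if same_class k j then base (j - 8 * b) (k - 8 * b) + 8 * b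
  else if k < j then base (if odd j then 2 else 1) (k - 8 * b) + 8 * b
  else base (if odd j then 1 else 2) (k - 8 * b) + 8 * b.

Definition pi_seq (n j : nat) : seq nat := [seq pi_entry j k | k <- iota 1 (2 ^ n)].

Lemma base_in l k : l \in upto 8 -> k \in upto 8 -> base l k \in upto 8.
Proof. by do 9?[case: l => [|l] //]; do 9?[case: k => [|k] //]. Qed.

Lemma base_inj l : l \in upto 8 -> {in upto 8 &, injective (base l)}.
Proof.
move=> l_in x y x_in y_in /eqP; rewrite /base nth_uniq.
- by move: x_in y_in; rewrite !inE => ? ? /eqP; lia.
- by move: x_in l_in; rewrite !inE; do 9?[case: l => [|l] //=]; lia.
- by move: y_in l_in; rewrite !inE; do 9?[case: l => [|l] //=]; lia.
by move: l_in; do 9?[case: l => [|l] //=].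
Qed.

Lemma pi_entry3E j k : j \in upto 8 -> k \in upto 8 -> pi_entry j k = base j k.
Proof. by do 9?[case: j => [|j] //]; do 9?[case: k => [|k] //]. Qed.

(* Inside each class the entries are given by a single base permutation. *)
Lemma pi_entryE j b : 0 < j -> exists2 l, l \in upto 8 &
  forall k, 0 < k -> blk k = b -> pi_entry j k = base l (k - 8 * b) + 8 * b.
Proof.
move=> j_gt0; case: (eqVneq (blk j) b) => [jb | jb].
  exists (j - 8 * b); first by rewrite -jb sub_blk.
  by move=> k _ kb; rewrite /pi_entry same_classE kb jb eqxx.
exists (if (b < blk j) then if odd j then 2 else 1 else if odd j then 1 else 2).
  by do 2?case: ifP.
move=> k k_gt0 kb; rewrite /pi_entry same_classE kb eq_sym (negPf jb).
have -> : (k < j) = (b < blk j) by move: kb jb; rewrite /blk; lia.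
by case: ifP.
Qed.

Lemma pi_seq_perm n j : 3 <= n -> j \in upto (2 ^ n) ->
  perm_eq (pi_seq n j) (iota 1 (2 ^ n)).
Proof.
move=> n_ge3; rewrite inE => /andP[j_gt0 _].
have [m Dm] : exists m, 2 ^ n = 8 * m.
  by exists (2 ^ (n - 3)); rewrite -[8]/(2 ^ 3) -expnD subnKC.
have entry_blk k : 0 < k -> 0 < pi_entry j k /\ blk (pi_entry j k) = blk k.
  move=> k_gt0; have [l l_in ->//] := pi_entryE (blk k) j_gt0.
  have := base_in l_in (sub_blk k_gt0); move: (base _ _) => x; rewrite !inE.
  move=> x_in; split; first by lia.
  by apply/eqP; rewrite blkP; lia.
have pi_uniq : uniq (pi_seq n j).
  rewrite map_inj_in_uniq ?iota_uniq // => x y.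
  rewrite !mem_iota => /andP[x_gt0 _] /andP[y_gt0 _] eq_xy.
  have [_ bx] := entry_blk x x_gt0; have [_ by_] := entry_blk y y_gt0.
  have eq_b : blk y = blk x by rewrite -by_ -eq_xy bx.
  have [l l_in El] := pi_entryE (blk x) j_gt0.
  move: eq_xy; rewrite !El // => /addIn /base_inj-/(_ l_in (sub_blk x_gt0)).
  rewrite -{1}eq_b => /(_ (sub_blk y_gt0)).
  have := sub_blk x_gt0; have := sub_blk y_gt0; rewrite !inE eq_b; lia.
have sub_pi : {subset pi_seq n j <= iota 1 (2 ^ n)}.
  move=> _ /mapP[k k_in ->]; move: k_in; rewrite !mem_iota Dm => k_in.
  have k_gt0 : 0 < k by case/andP: k_in.
  have [e_gt0 /eqP] := entry_blk k k_gt0; rewrite blkP //.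
  have := eqxx (blk k); rewrite blkP //; move: k_in; lia.
apply: uniq_perm => //; first exact: iota_uniq.
by have [] := uniq_min_size pi_uniq sub_pi; rewrite ?size_map.
Qed.

Definition pi_bracket (n j : nat) (n_ge3 : 3 <= n) (j_in : j \in upto (2 ^ n)) :
  bracket n := Bracket (pi_seq_perm n_ge3 j_in).

(* Main.v *)
(* The candidates of a class play among themselves during the first three
   rounds, so after them the class C_(b+1) is represented by l + 8 b, where the
   l-th base permutation was used in it (the winner of that permutation in G_3
   is l).  The representative of the class of j is j; a class below j is
   represented by a candidate of the opposite parity, a class above j by one of
   the same parity.  Hence j beats all other survivors and wins, wherever they
   are placed. *)
Require Import Defs.
From mathcomp Require Import all_boot.
From mathcomp Require Import zify.

Set Implicit Arguments.
Unset Strict Implicit.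
Unset Printing Implicit Defensive.

(** Induction that follows the recursion of [play_round], which consumes two entries at a time. *)
Lemma seq_pair_ind (T : Type) (P : seq T -> Prop) :
  P [::] -> (forall a, P [:: a]) -> (forall a b s, P s -> P [:: a, b & s]) ->
  forall s, P s.
Proof.
move=> P0 P1 P2; fix IH 1; case=> [|a [|b s]].
- exact: P0.
- exact: P1.
- exact: P2 (IH s).
Qed.

Lemma play_round_sub (G : rel nat) s : {subset play_round G s <= s}.
Proof.
elim/seq_pair_ind: s => [|a|a b s IH] //= x.
rewrite !inE => /predU1P[->|/IH->]; last by rewrite !orbT.
by rewrite /match_winner; case: ifP; rewrite eqxx ?orbT.
Qed.

(** Since the left part has even length, no match straddles the cut. *)
Lemma play_round_cat (G : rel nat) s1 s2 : ~~ odd (size s1) ->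
  play_round G (s1 ++ s2) = play_round G s1 ++ play_round G s2.
Proof.
elim/seq_pair_ind: s1 => [|a|a b s1 IH] //=.
by rewrite negbK => /IH ->.
Qed.

Lemma play_round_map (G G' : rel nat) f s :
  {in s &, forall x y, G (f x) (f y) = G' x y} ->
  play_round G (map f s) = map f (play_round G' s).
Proof.
elim/seq_pair_ind: s => [|a|a b s IH] //= GG'.
rewrite IH => [|x y xs ys]; last by apply: GG'; rewrite !inE ?xs ?ys !orbT.
by rewrite /match_winner GG' ?inE ?eqxx ?orbT //; case: ifP.
Qed.

Lemma iter_play_round_map (G G' : rel nat) f k s :
  {in s &, forall x y, G (f x) (f y) = G' x y} ->
  iter k (play_round G) (map f s) = map f (iter k (play_round G') s).
Proof.
elim: k s => [|k IH] s GG' //.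
rewrite !iterSr (play_round_map GG') IH // => x y xs ys.
by apply: GG'; apply: play_round_sub; eassumption.
Qed.

(** Divisibility by [2 ^ k] keeps the length of the left part even before each of the [k] rounds. *)
Lemma iter_play_round_cat (G : rel nat) k s1 s2 : 2 ^ k %| size s1 ->
  iter k (play_round G) (s1 ++ s2) =
    iter k (play_round G) s1 ++ iter k (play_round G) s2.
Proof.
elim: k s1 s2 => [|k IH] s1 s2 // /dvdnP[m Dm].
have size_s1 : size s1 = (m * 2 ^ k).*2 by rewrite Dm expnS; lia.
rewrite !iterSr play_round_cat ?size_s1 ?odd_double // IH //.
by rewrite (size_play_round G size_s1) dvdn_mull.
Qed.

Lemma iter_play_round_flatten (G : rel nat) k (I : eqType) (r : seq I)
    (F : I -> seq nat) (f : I -> nat) :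
  {in r, forall i, 2 ^ k %| size (F i)} ->
  {in r, forall i, iter k (play_round G) (F i) = [:: f i]} ->
  iter k (play_round G) (flatten (map F r)) = map f r.
Proof.
elim: r => [|i r IH] /= sz_F FG; first by elim: k {sz_F FG} => //= k ->.
rewrite iter_play_round_cat ?sz_F ?mem_head // FG ?mem_head // IH //.
  by move=> x xr; apply: sz_F; rewrite inE xr orbT.
by move=> x xr; apply: FG; rewrite inE xr orbT.
Qed.

(** In each round [x] wins its match, and its later opponents still come from [s]. Both conditions
    on [G] are needed because [match_winner] only tests the arrow from the left entry to the right
    one, and [x] may stand on either side. *)
Lemma dominant_wins (G : rel nat) m s x : size s = 2 ^ m -> x \in s ->
  {in s, forall y, y != x -> G x y && ~~ G y x} ->
  iter m (play_round G) s = [:: x].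
Proof.
elim: m s => [|m IH] s; first by case: s => [|a []] //= _; rewrite inE => /eqP->.
rewrite expnS mul2n => sz_s xs dom; rewrite iterSr; apply: IH.
- exact: size_play_round.
- elim/seq_pair_ind: s {sz_s} xs dom => [|a|a b s IHs] //= xs dom.
  (* Repetitions in [s] are allowed: either [x] occurs after the first match, or it takes part in
     it, possibly against itself. *)
  have [xs'|xs'] := boolP (x \in s).
    by rewrite inE IHs ?orbT // => y ys; apply: dom; rewrite !inE ys !orbT.
  move: xs; rewrite !inE (negPf xs') orbF /match_winner => xab.
  have doma : a != x -> G x a && ~~ G a x by apply: dom; rewrite mem_head.
  have domb : b != x -> G x b && ~~ G b x by apply: dom; rewrite !inE eqxx orbT.
  case/orP: xab => /eqP ex; rewrite -ex.
    by have [->|/domb/andP[->]] := eqVneq b x; rewrite ?if_same eqxx.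
  by have [->|/doma/andP[_ /negPf->]] := eqVneq a x; rewrite ?if_same eqxx.
- by move=> y /play_round_sub; apply: dom.
Qed.

(** A finite check by computation, one tournament for each [l] from 1 to 8. *)
Lemma base_winner l : l \in upto 8 ->
  iter 3 (play_round [rel x y : nat | (x, y) \in E3]) (map (base l) (iota 1 8)) =
    [:: l].
Proof. by do 9?[case: l => [|l] //]. Qed.

Lemma blk_add x b : x \in upto 8 -> blk (x + 8 * b) = b.
Proof. by rewrite /blk inE; lia. Qed.

Lemma Gn_class n b : 8 * b.+1 <= 2 ^ n -> {in upto 8 &, forall x y,
  Gn n (x + 8 * b) (y + 8 * b) = ((x, y) \in E3)}.
Proof.
move=> le_b x y x8 y8; rewrite /= /Gn_arrow same_classE !blk_add // eqxx !addnK.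
by move: x8 y8; case: (_ \in E3); rewrite !inE; lia.
Qed.

(* The base permutation used by the bracket of j in the class C_(b+1). *)
Definition class_perm (j b : nat) : nat :=
  if blk j == b then j - 8 * b
  else if b < blk j then if odd j then 2 else 1
  else if odd j then 1 else 2.

Lemma class_perm_in j b : 0 < j -> class_perm j b \in upto 8.
Proof.
move=> j_gt0; rewrite /class_perm; case: eqP => [<-|_]; first exact: sub_blk.
by do 2?case: ifP.
Qed.

Lemma pi_entry_class j b k : k \in upto 8 ->
  pi_entry j (k + 8 * b) = base (class_perm j b) k + 8 * b.
Proof.
move=> k8; rewrite /pi_entry /class_perm same_classE blk_add // addnK eq_sym.
case: eqP => // jb.
(* Outside the class of [j], comparing a position with [j] amounts to comparing their classes. *)
have -> : (k + 8 * b < j) = (b < blk j) by move: k8 jb; rewrite !inE /blk; lia.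
by case: ifP.
Qed.

(** Translation by [8 * b] carries the tournament of [E3] to the one inside the class, so
    [base_winner] transfers. *)
Lemma class_winner n j b : 0 < j -> 8 * b.+1 <= 2 ^ n ->
  iter 3 (play_round (Gn n)) [seq pi_entry j k | k <- iota (1 + 8 * b) 8] =
    [:: class_perm j b + 8 * b].
Proof.
move=> j_gt0 le_b; have l8 := class_perm_in b j_gt0.
have -> : [seq pi_entry j k | k <- iota (1 + 8 * b) 8] =
    map (addn^~ (8 * b)) (map (base (class_perm j b)) (iota 1 8)).
  rewrite addnC iotaDl -!map_comp; apply/eq_in_map => k.
  by rewrite mem_iota => k8; rewrite [LHS]/= addnC; apply: pi_entry_class.
rewrite (@iter_play_round_map _ [rel x y : nat | (x, y) \in E3]) ?base_winner //.
have base8 x : x \in map (base (class_perm j b)) (iota 1 8) -> x \in upto 8.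
  by case/mapP=> k; rewrite mem_iota => k8 ->; apply: base_in.
by move=> x y /base8 x8 /base8 y8; apply: Gn_class.
Qed.

Lemma iota_blocks d i m :
  iota i (d * m) = flatten [seq iota (i + d * b) d | b <- iota 0 m].
Proof.
elim: m => [|m IH]; first by rewrite muln0.
by rewrite mulnS addnC iotaD IH -addn1 iotaD map_cat flatten_cat /= cats0.
Qed.

Lemma class_perm_dominated n j b : j \in upto (2 ^ n) -> 8 * b.+1 <= 2 ^ n ->
  let y := class_perm j b + 8 * b in y != j -> Gn n j y && ~~ Gn n y j.
Proof.
move=> j_in le_b y; have j_gt0 : 0 < j by case/andP: j_in.
have l8 := class_perm_in b j_gt0.
have y_in : y \in upto (2 ^ n) by move: l8; rewrite /y !inE; lia.
move=> yj; have := Gn_arrow_total j_in y_in; rewrite eq_sym => /(_ yj).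
(* Exactly one of the two arrows between [j] and [y] is present. *)
suff jy : Gn_arrow n j y by rewrite /= jy.
rewrite /Gn_arrow j_in y_in same_classE blk_add //=.
(* In the class of [j], [y] would be [j] itself. Elsewhere [8 * b] is even, so [y] has the parity of
   [class_perm j b]. *)
move: yj; rewrite /y /class_perm /blk; move: j_gt0.
by do !case: ifP; lia.
Qed.

Theorem theorem1 (n : nat) (n_ge3 : 3 <= n) (j : nat) (j_in : j \in upto (2 ^ n)) :
  winner (Gn n) (pi_bracket n_ge3 j_in) = j.
Proof.
have Dn : 2 ^ n = 8 * 2 ^ (n - 3) by rewrite -[8]/(2 ^ 3) -expnD subnKC.
have j_gt0 : 0 < j by case/andP: (j_in).
have le_b b : b \in iota 0 (2 ^ (n - 3)) -> 8 * b.+1 <= 2 ^ n.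
  by rewrite mem_iota Dn; lia.
rewrite /winner /= /pi_seq Dn iota_blocks map_flatten -map_comp.
(* Three rounds inside the [2 ^ (n - 3)] classes, then [n - 3] rounds among their winners. *)
rewrite -[X in iter X](subnK n_ge3) iterD.
rewrite (iter_play_round_flatten (f := fun b => class_perm j b + 8 * b)).
- rewrite (@dominant_wins _ _ _ j) ?size_map ?size_iota //.
    apply/mapP; exists (blk j); last first.
      by rewrite /class_perm eqxx; move: j_gt0; rewrite /blk; lia.
    by rewrite mem_iota; move: j_in; rewrite inE Dn /blk; lia.
  by move=> _ /mapP[b /le_b b_le ->]; apply: class_perm_dominated.
- by [].
- by move=> b /le_b; apply: class_winner.
Qed.
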